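(* For every integer $n\ge 2$, $n\le st_{\mathcal{D}}(n)\le 2n-2$.
   Context: For a finite set $P$ of points in the plane in general position, $st_{\mathcal{D}}(P)$ is the minimum of $|W|$ over finite point sets $W$ with $P\cup W$ in general position such that every open disk whose boundary circle passes through two distinct points of $P$ contains a point of $W$ (equivalently, such that the witness Delaunay graph $\mathrm{DG}^-(P,W)$ has no edges, where distinct $x,y\in P$ are adjacent in $\mathrm{DG}^-(P,W)$ iff some open disk containing no point of $W$ has $x,y$ on its bounding circle). Define $st_{\mathcal{D}}(n)=\max\{st_{\mathcal{D}}(P): P \text{ a set of } n \text{ points in general position}\}$. General position means no three distinct points are collinear and no four distinct points are concyclic. *)

(* Defs.v *)
From Stdlib Require Import Reals List.
Open Scope R_scope.

Definition pt : Type := (R * R)%type.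

Definition dist2 (p q : pt) : R :=
  (fst p - fst q) * (fst p - fst q) + (snd p - snd q) * (snd p - snd q).

Definition collinear (a b c : pt) : Prop :=
  (fst b - fst a) * (snd c - snd a) - (snd b - snd a) * (fst c - fst a) = 0.

Definition concyclic (a b c d : pt) : Prop :=
  exists (o : pt) (r2 : R), 0 < r2 /\
    dist2 a o = r2 /\ dist2 b o = r2 /\ dist2 c o = r2 /\ dist2 d o = r2.

Definition general_position (S : list pt) : Prop :=
  (forall a b c, In a S -> In b S -> In c S ->
     a <> b -> a <> c -> b <> c -> ~ collinear a b c) /\
  (forall a b c d, In a S -> In b S -> In c S -> In d S ->
     a <> b -> a <> c -> a <> d -> b <> c -> b <> d -> c <> d ->
     ~ concyclic a b c d).

Definition stabs_all_disks (P W : list pt) : Prop :=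
  forall (x y o : pt) (r2 : R), In x P -> In y P -> x <> y ->
    dist2 x o = r2 -> dist2 y o = r2 ->
    exists w, In w W /\ dist2 w o < r2.

(* W is an admissible witness set for P (finite set = duplicate-free list);
   P ++ W represents the set P ∪ W *)
Definition witness_set (P W : list pt) : Prop :=
  NoDup W /\ general_position (P ++ W) /\ stabs_all_disks P W.

Definition stD_ge (P : list pt) (k : nat) : Prop :=
  forall W, witness_set P W -> (k <= length W)%nat.

Definition stD_le (P : list pt) (k : nat) : Prop :=
  exists W, witness_set P W /\ (length W <= k)%nat.

Definition gp_set (n : nat) (P : list pt) : Prop :=
  NoDup P /\ length P = n /\ general_position P.

(* Main.v *)
Require Import Defs.
From Stdlib Require Import Reals List Lra Lia Psatz Arith Classical IndefiniteDescription.
From Coquelicot Require Import Coquelicot.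

(** Upper bound: fix a generic direction [d] and put a witness near [p + h d] for every point
    except the last one in direction [d], and near [q - h d] for every point except the first.
    If [p] precedes [q], the centre of a disk through [p] and [q] is either well after [p] or
    well before [q], so the disk contains one of the two corresponding witnesses. The condition
    is open, hence the witnesses can be moved to general position.

    Lower bound, [n >= 3]: perturb a regular [n]-gon. Choosing the direction of the first centre
    seen from [p 0] determines disks through [p i, p (i+1)], consecutive ones being tangent;
    for the regular polygon and a direction close to the tangent of its circumcircle,
    non-consecutive ones stay apart, also after a small perturbation. So [n - 1] witnesses can
    stab all [n] disks only if one of them lies in the overlap at [p 0] of the last disk and the
    first. For odd [n] the direction can be chosen so that the chain closes up and there is no
    overlap. For even [n] every direction nearly closes up, and the overlaps of [n] chains with
    distinct directions lie in disjoint thin wedges at [p 0], so they need [n] witnesses. *)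

(** * General position by perturbation *)

Definition close (e : R) (p q : pt) : Prop :=
  Rabs (fst p - fst q) < e /\ Rabs (snd p - snd q) < e.

(** Nowhere density, phrased with sup-norm boxes. Unlike having empty interior, it passes to finite
    unions, so finitely many forbidden loci can be avoided at once. *)
Definition thin (S : pt -> Prop) : Prop :=
  forall q e, 0 < e -> exists q' e', 0 < e' /\
    forall w, close e' w q' -> close e w q /\ ~ S w.

Lemma close_refl e p : 0 < e -> close e p p.
Proof. intros He; split; rewrite Rminus_diag, Rabs_R0; exact He. Qed.

Lemma close_shrink q e q' :
  close e q' q -> exists e', 0 < e' /\ forall w, close e' w q' -> close e w q.
Proof.
  intros [H1 H2].
  set (d := Rmin (e - Rabs (fst q' - fst q)) (e - Rabs (snd q' - snd q))).
  exists d; split.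
  - apply Rmin_glb_lt; lra.
  - pose proof (Rmin_l (e - Rabs (fst q' - fst q)) (e - Rabs (snd q' - snd q))) as L1.
    pose proof (Rmin_r (e - Rabs (fst q' - fst q)) (e - Rabs (snd q' - snd q))) as L2.
    fold d in L1, L2.
    intros w [W1 W2]; split.
    + pose proof (Rabs_triang (fst w - fst q') (fst q' - fst q)) as T.
      replace (fst w - fst q' + (fst q' - fst q)) with (fst w - fst q) in T by ring. lra.
    + pose proof (Rabs_triang (snd w - snd q') (snd q' - snd q)) as T.
      replace (snd w - snd q' + (snd q' - snd q)) with (snd w - snd q) in T by ring. lra.
Qed.

Lemma thin_empty (S : pt -> Prop) : (forall w, ~ S w) -> thin S.
Proof. intros H q e He; exists q, e; auto. Qed.

Lemma thin_sub (S S' : pt -> Prop) : (forall w, S w -> S' w) -> thin S' -> thin S.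
Proof.
  intros H T q e He; destruct (T q e He) as (q' & e' & He' & K).
  exists q', e'; split; auto. intros w Hw; destruct (K w Hw); auto.
Qed.

Lemma thin_or (S S' : pt -> Prop) : thin S -> thin S' -> thin (fun w => S w \/ S' w).
Proof.
  intros T T' q e He; destruct (T q e He) as (q1 & e1 & He1 & K1).
  destruct (T' q1 e1 He1) as (q2 & e2 & He2 & K2).
  exists q2, e2; split; auto; intros w Hw.
  destruct (K2 w Hw) as [C N]; destruct (K1 w C); tauto.
Qed.

Lemma thin_exists (A : Type) (L : list A) (S : A -> pt -> Prop) :
  (forall a, In a L -> thin (S a)) -> thin (fun w => exists a, In a L /\ S a w).
Proof.
  induction L as [|a L IH]; intros H.
  - apply thin_empty; intros w (a & [] & _).
  - apply thin_sub with (fun w => S a w \/ exists b, In b L /\ S b w).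
    + intros w (b & [<-|Hb] & Hw); eauto.
    + apply thin_or; [apply H; left; auto | apply IH; intros b Hb; apply H; right; auto].
Qed.

Lemma thin_witness (S : pt -> Prop) q e :
  thin S -> 0 < e -> exists w, close e w q /\ ~ S w.
Proof.
  intros T He; destruct (T q e He) as (q' & e' & He' & K).
  exists q'; apply K, close_refl, He'.
Qed.

(** Lines ([A = 0]), circles and single points are all zero sets of this form, so one thinness
    result covers every degeneracy. *)
Definition quadric (A B C D : R) (w : pt) : R :=
  A * (fst w * fst w + snd w * snd w) + B * fst w + C * snd w + D.

Lemma quadric_nonzero_near A B C D q e :
  ~ (A = 0 /\ B = 0 /\ C = 0 /\ D = 0) -> 0 < e ->
  exists w, close e w q /\ quadric A B C D w <> 0.
Proof.
  intros N He. apply NNPP; intros H.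
  assert (Z : forall u v, Rabs u < e -> Rabs v < e ->
            quadric A B C D (fst q + u, snd q + v) = 0).
  { intros u v Hu Hv. apply NNPP; intros K; apply H.
    exists (fst q + u, snd q + v); split; auto.
    split; simpl; match goal with |- Rabs ?x < _ => ring_simplify x end; auto. }
  set (h := e / 2).
  assert (Hh : 0 < h) by (unfold h; lra).
  assert (A1 : Rabs h < e) by (rewrite Rabs_pos_eq; unfold h; lra).
  assert (A2 : Rabs (- h) < e) by (rewrite Rabs_Ropp; auto).
  assert (A0 : Rabs 0 < e) by (rewrite Rabs_R0; auto).
  pose proof (Z 0 0 A0 A0) as Z0.
  pose proof (Z h 0 A1 A0) as Z1.
  pose proof (Z (-h) 0 A2 A0) as Z2.
  pose proof (Z 0 h A0 A1) as Z3.
  unfold quadric in *; simpl in *.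
  (* The second difference along the first axis isolates [A]; first differences along the two axes
     then give [B] and [C]. *)
  assert (EA : A * (h * h) = 0) by lra.
  assert (A = 0) by (apply Rmult_integral in EA as [?|?]; auto; nra). subst A.
  assert (EB : B * h = 0) by lra. assert (B = 0) by (apply Rmult_integral in EB as [?|?]; lra). subst B.
  assert (EC : C * h = 0) by lra. assert (C = 0) by (apply Rmult_integral in EC as [?|?]; lra). subst C.
  apply N; repeat split; lra.
Qed.

(** An explicit modulus of continuity; [d <= 1] absorbs the squared displacements into the linear
    bound. *)
Lemma quadric_increment A B C D q w d :
  d <= 1 -> close d w q ->
  Rabs (quadric A B C D w - quadric A B C D q) <=
    d * (Rabs A * (2 * Rabs (fst q) + 2 * Rabs (snd q) + 2) + Rabs B + Rabs C).
Proof.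
  intros Hd [H1 H2].
  set (u := fst w - fst q) in *; set (v := snd w - snd q) in *.
  replace (quadric A B C D w - quadric A B C D q)
    with (A * (2 * fst q * u + u * u + (2 * snd q * v + v * v)) + B * u + C * v)
    by (unfold quadric, u, v; ring).
  set (x := fst q); set (y := snd q).
  pose proof (Rabs_pos u); pose proof (Rabs_pos v).
  pose proof (Rabs_pos A); pose proof (Rabs_pos B); pose proof (Rabs_pos C).
  pose proof (Rabs_pos x); pose proof (Rabs_pos y).
  assert (S1 : forall t s, Rabs t < d -> Rabs (2 * s * t + t * t) <= d * (2 * Rabs s + 1)).
  { intros t s Ht. replace (2 * s * t + t * t) with ((2 * s + t) * t) by ring.
    rewrite Rabs_mult. pose proof (Rabs_triang (2 * s) t) as T.
    rewrite Rabs_mult, (Rabs_pos_eq 2) in T by lra.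
    pose proof (Rabs_pos t); pose proof (Rabs_pos s).
    rewrite Rmult_comm. apply Rmult_le_compat; try apply Rabs_pos; lra. }
  pose proof (S1 u x H1) as U; pose proof (S1 v y H2) as V.
  eapply Rle_trans; [apply Rabs_triang|].
  eapply Rle_trans; [apply Rplus_le_compat_r, Rabs_triang|].
  rewrite !Rabs_mult.
  pose proof (Rabs_triang (2 * x * u + u * u) (2 * y * v + v * v)).
  assert (Rabs A * Rabs (2 * x * u + u * u + (2 * y * v + v * v))
          <= Rabs A * (d * (2 * Rabs x + 2 * Rabs y + 2)))
    by (apply Rmult_le_compat_l; lra).
  assert (Rabs B * Rabs u <= Rabs B * d) by (apply Rmult_le_compat_l; lra).
  assert (Rabs C * Rabs v <= Rabs C * d) by (apply Rmult_le_compat_l; lra).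
  lra.
Qed.

Lemma thin_quadric A B C D :
  ~ (A = 0 /\ B = 0 /\ C = 0 /\ D = 0) -> thin (fun w => quadric A B C D w = 0).
Proof.
  intros N q e He.
  destruct (quadric_nonzero_near A B C D q e N He) as (q' & C1 & F).
  destruct (close_shrink q e q' C1) as (e1 & He1 & K).
  set (M := Rabs A * (2 * Rabs (fst q') + 2 * Rabs (snd q') + 2) + Rabs B + Rabs C).
  assert (HM : 0 <= M).
  { unfold M. pose proof (Rabs_pos A); pose proof (Rabs_pos B); pose proof (Rabs_pos C).
    pose proof (Rabs_pos (fst q')); pose proof (Rabs_pos (snd q')). nra. }
  set (f := Rabs (quadric A B C D q')).
  assert (Hf : 0 < f) by (apply Rabs_pos_lt; auto).
  (* On a box of this size the increment is at most [d * M], which is less than [f], so the value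
     cannot reach zero. *)
  set (d := Rmin 1 (f / (M + 1))).
  assert (Hd : 0 < d) by (apply Rmin_glb_lt; [lra | apply Rdiv_lt_0_compat; lra]).
  assert (d <= 1) by apply Rmin_l.
  assert (Hdf : d * (M + 1) <= f).
  { apply Rle_trans with (f / (M + 1) * (M + 1)).
    - apply Rmult_le_compat_r; [lra | apply Rmin_r].
    - right; field; lra. }
  exists q', (Rmin d e1); split; [apply Rmin_glb_lt; auto|].
  intros w [W1 W2].
  pose proof (Rmin_l d e1); pose proof (Rmin_r d e1).
  split; [apply K; split; lra|].
  intros Z.
  assert (CW : close d w q') by (split; lra).
  pose proof (quadric_increment A B C D q' w d ltac:(auto) CW) as I.
  rewrite Z, Rminus_0_l, Rabs_Ropp in I. fold f M in I. lra.
Qed.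

(** * Extending a set while keeping general position *)

Lemma general_position_incl L L' :
  incl L' L -> general_position L -> general_position L'.
Proof.
  intros I [H1 H2]; split; intros.
  - apply H1; auto.
  - apply H2; auto.
Qed.

Lemma pt_neq a b : a <> b -> fst b - fst a <> 0 \/ snd b - snd a <> 0.
Proof.
  intros H; apply NNPP; intros K; apply H.
  destruct a, b; simpl in *; f_equal; apply NNPP; intros ?; apply K; [left|right]; lra.
Qed.

Lemma thin_point a : thin (fun w => w = a).
Proof.
  apply thin_sub with (fun w => quadric 1 (- 2 * fst a) (- 2 * snd a)
                          (fst a * fst a + snd a * snd a) w = 0).
  - intros w ->; unfold quadric; ring.
  - apply thin_quadric; intros (H & _); lra.
Qed.

Lemma thin_line a b : a <> b -> thin (collinear a b).
Proof.
  intros N.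
  apply thin_sub with (fun w => quadric 0 (- (snd b - snd a)) (fst b - fst a)
     ((snd b - snd a) * fst a - (fst b - fst a) * snd a) w = 0).
  - intros w H; unfold collinear in H; unfold quadric; lra.
  - apply thin_quadric; intros (_ & H1 & H2 & _).
    destruct (pt_neq a b N); lra.
Qed.

(** With coordinates relative to [a], Cramer's rule gives twice the centre as [(X / k, Y / k)].
    Eliminating it leaves a quadric in [w] with leading coefficient [k], the collinearity
    determinant, which is nonzero. *)
Lemma thin_circle a b c : ~ collinear a b c -> thin (concyclic a b c).
Proof.
  intros N.
  set (bx := fst b - fst a); set (by' := snd b - snd a).
  set (cx := fst c - fst a); set (cy := snd c - snd a).
  set (k := bx * cy - by' * cx).
  set (X := (bx * bx + by' * by') * cy - (cx * cx + cy * cy) * by').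
  set (Y := (cx * cx + cy * cy) * bx - (bx * bx + by' * by') * cx).
  apply thin_sub with (fun w => quadric k (- 2 * k * fst a - X) (- 2 * k * snd a - Y)
     (k * (fst a * fst a + snd a * snd a) + X * fst a + Y * snd a) w = 0).
  - intros w ([ox oy] & r2 & _ & Ha & Hb & Hc & Hw).
    unfold dist2 in *; simpl in *.
    set (u := ox - fst a); set (v := oy - snd a).
    set (wx := fst w - fst a); set (wy := snd w - snd a).
    assert (Eb : bx * bx + by' * by' = 2 * (u * bx + v * by')) by (unfold u, v, bx, by'; lra).
    assert (Ec : cx * cx + cy * cy = 2 * (u * cx + v * cy)) by (unfold u, v, cx, cy; lra).
    assert (Ew : wx * wx + wy * wy = 2 * (u * wx + v * wy)) by (unfold u, v, wx, wy; lra).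
    transitivity (k * (wx * wx + wy * wy) - X * wx - Y * wy);
      [unfold quadric, wx, wy; ring|].
    unfold X, Y; rewrite Eb, Ec, Ew; unfold k; ring.
  - apply thin_quadric; intros (H & _). apply N; exact H.
Qed.

(** A bad new point is an old point or lies on one of the finitely many lines through two, or
    circles through three, old points. *)
Lemma thin_bad_extension L :
  general_position L -> thin (fun w => In w L \/ ~ general_position (w :: L)).
Proof.
  intros [G1 G2].
  apply thin_sub with (fun w => exists a, In a L /\ (w = a \/
    exists b, In b L /\ ((a <> b /\ collinear a b w) \/
    exists c, In c L /\ (a <> b /\ a <> c /\ b <> c /\ concyclic a b c w)))).
  - intros w H; apply NNPP; intros K.
    assert (K0 : ~ In w L) by (intros ?; apply K; eauto).
    assert (K1 : forall a b, In a L -> In b L -> a <> b -> ~ collinear a b w).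
    { intros a b ? ? ? ?; apply K; exists a; split; auto; right; exists b; auto. }
    assert (K2 : forall a b c, In a L -> In b L -> In c L -> a <> b -> a <> c -> b <> c ->
               ~ concyclic a b c w).
    { intros a b c ? ? ? ? ? ? ?; apply K; exists a; split; auto; right; exists b; split; auto.
      right; exists c; auto. }
    destruct H as [H|H]; [auto|]; apply H; split.
    + intros a b c [Ea|Ha] [Eb|Hb] [Ec|Hc] N1 N2 N3; subst; try congruence; auto.
      * intros E; apply (K1 b c); auto; unfold collinear in *; lra.
      * intros E; apply (K1 a c); auto; unfold collinear in *; lra.
    + intros a b c d [Ea|Ha] [Eb|Hb] [Ec|Hc] [Ed|Hd] N1 N2 N3 N4 N5 N6;
        subst; try congruence; auto; intros (o & r2 & Hr & E1 & E2 & E3 & E4).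
      * apply (K2 b c d); auto; exists o, r2; auto.
      * apply (K2 a c d); auto; exists o, r2; auto.
      * apply (K2 a b d); auto; exists o, r2; auto.
  - apply thin_exists; intros a Ha; apply thin_or; [apply thin_point|].
    apply thin_exists; intros b Hb; apply thin_or.
    + destruct (classic (a = b)) as [E|E]; [apply thin_empty; tauto|].
      apply thin_sub with (collinear a b); [tauto | apply thin_line, E].
    + apply thin_exists; intros c Hc.
      destruct (classic (a <> b /\ a <> c /\ b <> c)) as [(E1 & E2 & E3)|E];
        [|apply thin_empty; tauto].
      apply thin_sub with (concyclic a b c); [tauto | apply thin_circle, G1; auto].
Qed.

(** The targets are treated one at a time, each new point avoiding the thin bad set of [P] and the
    points already chosen; hence the induction varies [P]. *)
Lemma general_position_perturb T : forall P e, 0 < e -> general_position P ->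
  exists W, Forall2 (close e) W T /\ NoDup W /\ (forall w, In w W -> ~ In w P) /\
    general_position (P ++ W).
Proof.
  induction T as [|t T IH]; intros P e He G.
  - exists nil; rewrite app_nil_r; repeat split; try apply G; auto; try constructor.
  - destruct (thin_witness _ t e (thin_bad_extension P G) He) as (w & Cw & Nw).
    assert (Gw : general_position (w :: P)) by (apply NNPP; tauto).
    destruct (IH (w :: P) e He Gw) as (W & F & ND & Dis & GW).
    exists (w :: W); repeat split.
    + constructor; auto.
    + constructor; auto. intros Hw; apply (Dis w Hw); left; auto.
    + intros x [<-|Hx]; [tauto | intros HP; apply (Dis x Hx); right; auto].
    + revert GW; apply general_position_incl; intros x; simpl; rewrite !in_app_iff; simpl; tauto.
    + revert GW; apply general_position_incl; intros x; simpl; rewrite !in_app_iff; simpl; tauto.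
Qed.

(** * The upper bound *)

Definition vadd (p q : pt) : pt := (fst p + fst q, snd p + snd q).
Definition vsub (p q : pt) : pt := (fst p - fst q, snd p - snd q).
Definition vscale (k : R) (p : pt) : pt := (k * fst p, k * snd p).
Definition dot (p q : pt) : R := fst p * fst q + snd p * snd q.
Definition cross (p q : pt) : R := fst p * snd q - snd p * fst q.

Lemma Forall2_in_r (A B : Type) (Q : A -> B -> Prop) l l' y :
  Forall2 Q l l' -> In y l' -> exists x, In x l /\ Q x y.
Proof.
  induction 1 as [|a b l l' HQ F IH]; [intros []|].
  intros [<-|H]; [exists a; simpl; auto|].
  destruct (IH H) as (x & Hx & Qx); exists x; simpl; auto.
Qed.

(** The first condition orders the points strictly along [d]; the second keeps small displacements
    along [d] off the lines through two points. Each excludes finitely many lines through the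
    origin. *)
Lemma generic_direction (P : list pt) : exists d, forall p q, In p P -> In q P -> p <> q ->
  dot (vsub q p) d <> 0 /\ cross (vsub q p) d <> 0.
Proof.
  assert (T : thin (fun d => exists p, In p P /\ exists q, In q P /\
     (p <> q /\ (dot (vsub q p) d = 0 \/ cross (vsub q p) d = 0)))).
  { apply thin_exists; intros p _; apply thin_exists; intros q _.
    destruct (classic (p = q)) as [E|E]; [apply thin_empty; tauto|].
    pose proof (pt_neq p q E) as N.
    apply thin_sub with (fun d => quadric 0 (fst q - fst p) (snd q - snd p) 0 d = 0 \/
        quadric 0 (- (snd q - snd p)) (fst q - fst p) 0 d = 0).
    - intros d (_ & H); unfold dot, cross, vsub, quadric in *; simpl in *.
      destruct H; [left | right]; lra.
    - apply thin_or; apply thin_quadric; intros (_ & H1 & H2 & _); destruct N; lra. }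
  destruct (thin_witness _ (0, 0) 1 T ltac:(lra)) as (d & _ & N).
  exists d; intros p q Hp Hq E; split; intros H; apply N; exists p; split; auto; exists q; auto.
Qed.

Lemma uniform_bound (A : Type) (Q : A -> R -> Prop) (L : list A) :
  (forall a, In a L -> exists d0, 0 < d0 /\ forall d, 0 < d <= d0 -> Q a d) ->
  exists d0, 0 < d0 /\ forall a d, In a L -> 0 < d <= d0 -> Q a d.
Proof.
  induction L as [|a L IH]; intros H.
  - exists 1; split; [lra | intros a d []].
  - destruct IH as (d1 & H1 & K1); [intros; apply H; right; auto|].
    destruct (H a (or_introl eq_refl)) as (d2 & H2 & K2).
    exists (Rmin d1 d2); split; [apply Rmin_glb_lt; auto|].
    pose proof (Rmin_l d1 d2); pose proof (Rmin_r d1 d2).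
    intros b d [<-|Hb] Hd; [apply K2 | apply K1]; auto; lra.
Qed.

(* The centre [o] lies on the bisector of [p] and [q], so [2 o - p - q] is a multiple of the
   normal of [q - p]; as [v] and [u] lie on the same side of the line [p q], it cannot
   have a negative product with [v] and a positive one with [u]. *)
Lemma stab_pair p q v u o :
  dist2 p o = dist2 q o ->
  dot v v < dot (vsub q p) v -> dot u u < dot (vsub q p) u ->
  0 < cross (vsub q p) v * cross (vsub q p) u ->
  dist2 (vadd p v) o < dist2 p o \/ dist2 (vsub q u) o < dist2 q o.
Proof.
  intros E Hv Hu HX.
  apply NNPP; intros N; apply not_or_and in N as [N1 N2].
  apply Rnot_lt_le in N1, N2.
  set (e := vsub q p) in *.
  set (f := (2 * fst o - fst p - fst q, 2 * snd o - snd p - snd q) : pt).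
  assert (EF : dot e f = 0) by (unfold dot, e, f, vsub, dist2 in *; simpl; lra).
  assert (FV : dot f v < 0)
    by (unfold dot, e, f, vsub, vadd, dist2 in *; simpl in *; lra).
  assert (FU : 0 < dot f u)
    by (unfold dot, e, f, vsub, vadd, dist2 in *; simpl in *; lra).
  (* Since [dot e f = 0], the sign of [dot f x] is that of [cross e f * cross e x]. Opposite signs
     at [v] and [u] then contradict [HX]. *)
  assert (I : forall x, dot e e * dot f x = dot e f * dot e x + cross e f * cross e x)
    by (intros; unfold dot, cross; ring).
  assert (EE : 0 < dot e e).
  { assert (0 <= dot e e) by (unfold dot; nra).
    destruct (Req_dec (dot e e) 0) as [Z|Z]; [|lra].
    assert (fst e = 0) by (unfold dot in Z; nra).
    assert (snd e = 0) by (unfold dot in Z; nra).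
    unfold cross in HX; nra. }
  pose proof (I v) as Iv; pose proof (I u) as Iu; rewrite EF in Iv, Iu.
  assert (cross e f * cross e v < 0) by nra.
  assert (0 < cross e f * cross e u) by nra.
  assert ((cross e f * cross e v) * (cross e f * cross e u) < 0) by nra.
  assert (0 <= (cross e f * cross e f) * (cross e v * cross e u)) by nra.
  nra.
Qed.

(** Both claims hold to first order in [h], and every error, including [dot v v], is of order
    [h * h]. The tolerance [h * h] is what later leaves room to move the witnesses. *)
Lemma small_witness_vector e d :
  0 < dot e d -> cross e d <> 0 ->
  exists h0, 0 < h0 /\ forall h, 0 < h <= h0 -> forall v, close (h * h) v (vscale h d) ->
    dot v v < dot e v /\ 0 < cross e v * cross e d.
Proof.
  intros Hd Hc.
  destruct e as [e1 e2], d as [d1 d2]; unfold dot, cross, close, vscale in *; simpl in *.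
  (* For [h <= 1], [K * (h * h)] bounds [dot v v]; [M] collects the coefficients of all second-order
     terms. *)
  set (K := (Rabs d1 + 1) * (Rabs d1 + 1) + (Rabs d2 + 1) * (Rabs d2 + 1)).
  set (M := Rabs e1 + Rabs e2 + K + 1).
  set (c := Rabs (e1 * d2 - e2 * d1)).
  assert (Hc' : 0 < c) by (apply Rabs_pos_lt; auto).
  pose proof (Rabs_pos e1); pose proof (Rabs_pos e2).
  pose proof (Rabs_pos d1); pose proof (Rabs_pos d2).
  assert (HK : 0 <= K) by (unfold K; nra).
  assert (HM : 0 < M) by (unfold M; lra).
  set (m := Rmin (e1 * d1 + e2 * d2) c).
  assert (Hm : 0 < m) by (apply Rmin_glb_lt; auto).
  exists (Rmin 1 (m / M)); split.
  { apply Rmin_glb_lt; [lra | apply Rdiv_lt_0_compat; auto]. }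
  intros h [Hh0 Hh] [v1 v2]; simpl; intros [C1 C2].
  pose proof (Rmin_l 1 (m / M)); pose proof (Rmin_r 1 (m / M)).
  assert (HhM : h * M <= m).
  { apply Rle_trans with (m / M * M); [apply Rmult_le_compat_r; lra | right; field; lra]. }
  assert (m <= e1 * d1 + e2 * d2) by apply Rmin_l.
  assert (m <= c) by apply Rmin_r.
  set (a := v1 - h * d1) in *; set (b := v2 - h * d2) in *.
  replace v1 with (h * d1 + a) by (unfold a; ring).
  replace v2 with (h * d2 + b) by (unfold b; ring).
  assert (B : forall x y, Rabs y < h * h -> Rabs (x * y) <= Rabs x * (h * h)).
  { intros; rewrite Rabs_mult; apply Rmult_le_compat_l; [apply Rabs_pos | lra]. }
  assert (Q : forall x y, Rabs y < h * h ->
     (h * x + y) * (h * x + y) <= h * h * ((Rabs x + 1) * (Rabs x + 1))).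
  { intros x y Hy.
    assert (h * h <= h) by nra.
    assert (Rabs (h * x + y) <= h * (Rabs x + 1)).
    { eapply Rle_trans; [apply Rabs_triang|]. rewrite Rabs_mult, (Rabs_pos_eq h) by lra. lra. }
    replace ((h * x + y) * (h * x + y)) with (Rabs (h * x + y) * Rabs (h * x + y))
      by (rewrite <- Rabs_mult; apply Rabs_pos_eq, Rle_0_sqr).
    replace (h * h * ((Rabs x + 1) * (Rabs x + 1)))
      with (h * (Rabs x + 1) * (h * (Rabs x + 1))) by ring.
    apply Rmult_le_compat; auto; apply Rabs_pos. }
  pose proof (Q d1 a C1); pose proof (Q d2 b C2).
  pose proof (B e1 a C1) as B1; pose proof (B e2 b C2) as B2.
  pose proof (B e1 b C2) as B3; pose proof (B e2 a C1) as B4.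
  assert (S : h * h * (Rabs e1 + Rabs e2) + h * h * K < h * m).
  { assert (h * (h * M) <= h * m) by (apply Rmult_le_compat_l; lra). unfold M in *. nra. }
  split.
  - apply Rabs_le_between in B1; apply Rabs_le_between in B2.
    assert (h * m <= h * (e1 * d1 + e2 * d2)) by (apply Rmult_le_compat_l; lra).
    unfold K in *; lra.
  - apply Rabs_le_between in B3; apply Rabs_le_between in B4.
    assert (h * m <= h * c) by (apply Rmult_le_compat_l; lra).
    replace (e1 * (h * d2 + b) - e2 * (h * d1 + a))
      with (h * (e1 * d2 - e2 * d1) + (e1 * b - e2 * a)) by ring.
    assert (0 <= h * h * K) by nra.
    unfold c in *; destruct (Rcase_abs (e1 * d2 - e2 * d1)) as [L|L].
    + rewrite (Rabs_left _ L) in *; rewrite <- Rmult_opp_opp. apply Rmult_lt_0_compat; lra.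
    + rewrite (Rabs_right _ L) in *; apply Rmult_lt_0_compat; lra.
Qed.

Lemma list_max (A : Type) (f : A -> R) (L : list A) :
  L <> nil -> exists m, In m L /\ forall x, In x L -> f x <= f m.
Proof.
  induction L as [|a L IH]; [congruence|intros _].
  destruct L as [|b L].
  - exists a; split; simpl; auto. intros x [<-|[]]; lra.
  - destruct IH as (m & Hm & K); [congruence|].
    destruct (Rle_dec (f a) (f m)).
    + exists m; split; [right; auto|]. intros x [<-|Hx]; auto.
    + exists a; split; [left; auto|]. intros x [<-|Hx]; [lra|]. specialize (K x Hx); lra.
Qed.

Lemma list_delete (A : Type) (L : list A) m : In m L ->
  exists L', S (length L') = length L /\ forall x, In x L -> x <> m -> In x L'.
Proof.
  intros H; apply in_split in H as (l1 & l2 & ->).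
  exists (l1 ++ l2); split.
  - rewrite !length_app; simpl; lia.
  - intros x; rewrite !in_app_iff; simpl; intuition congruence.
Qed.

Lemma stD_upper n P : (2 <= n)%nat -> gp_set n P -> stD_le P (2 * n - 2).
Proof.
  intros hn (ND & Len & G).
  destruct (generic_direction P) as (d & Hd).
  assert (NE : P <> nil) by (intros ->; simpl in Len; lia).
  (* [M] is the last point along [d] and gets no forward witness; [m] below is the first and gets no
     backward one. This leaves [n - 1] witnesses of each kind. *)
  destruct (list_max _ (fun x => dot x d) P NE) as (M & HM & MaxM).
  destruct (list_max _ (fun x => - dot x d) P NE) as (m & Hm & MinM).
  destruct (list_delete _ P M HM) as (P1 & L1 & D1).
  destruct (list_delete _ P m Hm) as (P2 & L2 & D2).
  destruct (uniform_bound _ (fun (pq : pt * pt) h => 0 < dot (vsub (snd pq) (fst pq)) d ->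
     forall v, close (h * h) v (vscale h d) ->
       dot v v < dot (vsub (snd pq) (fst pq)) v /\
       0 < cross (vsub (snd pq) (fst pq)) v * cross (vsub (snd pq) (fst pq)) d)
     (list_prod P P)) as (h & Hh & K).
  { intros [p q] Hpq; simpl. apply in_prod_iff in Hpq as [Hp Hq].
    destruct (Rlt_dec 0 (dot (vsub q p) d)) as [L|L];
      [|exists 1; split; [lra | intros; contradiction]].
    assert (p <> q) by (intros ->; unfold dot, vsub in L; simpl in L; lra).
    destruct (small_witness_vector (vsub q p) d L) as (h0 & H0 & K0); [apply Hd; auto|].
    exists h0; split; [auto | intros h Hh _; apply K0; auto]. }
  set (T := map (fun p => vadd p (vscale h d)) P1 ++ map (fun q => vsub q (vscale h d)) P2).
  destruct (general_position_perturb T P (h * h)) as (W & FW & NW & _ & GW); auto.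
  { nra. }
  exists W; split.
  2: { rewrite (Forall2_length FW); unfold T; rewrite length_app, !length_map; lia. }
  split; [auto | split; [auto|]].
  (* As [p] precedes [q], it is not the last point and [q] is not the first, so both witnesses
     needed for [stab_pair] are present. *)
  assert (Main : forall p q o, In p P -> In q P -> 0 < dot (vsub q p) d ->
     dist2 p o = dist2 q o -> exists w, In w W /\ dist2 w o < dist2 p o).
  { intros p q o Hp Hq L E.
    assert (Ldot : dot p d < dot q d) by (unfold dot, vsub in *; simpl in *; lra).
    assert (T1 : In (vadd p (vscale h d)) T).
    { apply in_or_app; left. apply (in_map (fun p => vadd p (vscale h d))), D1; auto.
      intros ->. specialize (MaxM q Hq). lra. }
    assert (T2 : In (vsub q (vscale h d)) T).
    { apply in_or_app; right. apply (in_map (fun p => vsub p (vscale h d))), D2; auto.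
      intros ->. specialize (MinM p Hp). simpl in MinM. lra. }
    destruct (Forall2_in_r _ _ _ _ _ _ FW T1) as (w1 & W1 & C1).
    destruct (Forall2_in_r _ _ _ _ _ _ FW T2) as (w2 & W2 & C2).
    assert (Hpq : In (p, q) (list_prod P P)) by (apply in_prod; auto).
    assert (V1 : close (h * h) (vsub w1 p) (vscale h d)).
    { destruct C1 as [C1 C1']; unfold close, vsub, vadd, vscale in *; simpl in *; split;
      [replace (fst w1 - fst p - h * fst d) with (fst w1 - (fst p + h * fst d)) by ring
      |replace (snd w1 - snd p - h * snd d) with (snd w1 - (snd p + h * snd d)) by ring]; auto. }
    assert (V2 : close (h * h) (vsub q w2) (vscale h d)).
    { destruct C2 as [C2 C2']; unfold close, vsub, vadd, vscale in *; simpl in *; split;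
      rewrite <- Rabs_Ropp;
      [replace (- (fst q - fst w2 - h * fst d)) with (fst w2 - (fst q - h * fst d)) by ring
      |replace (- (snd q - snd w2 - h * snd d)) with (snd w2 - (snd q - h * snd d)) by ring]; auto. }
    destruct (K (p, q) h Hpq ltac:(lra) L _ V1) as [A1 B1].
    destruct (K (p, q) h Hpq ltac:(lra) L _ V2) as [A2 B2]. simpl in *.
    assert (B : 0 < cross (vsub q p) (vsub w1 p) * cross (vsub q p) (vsub q w2)).
    { set (c := cross (vsub q p) d) in *.
      assert (0 < (cross (vsub q p) (vsub w1 p) * c) * (cross (vsub q p) (vsub q w2) * c)) by nra.
      nra. }
    destruct (stab_pair p q (vsub w1 p) (vsub q w2) o E A1 A2 B) as [S|S].
    - exists w1; split; auto.
      replace w1 with (vadd p (vsub w1 p)); auto.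
      unfold vadd, vsub; destruct w1; simpl; f_equal; ring.
    - exists w2; split; auto. rewrite E.
      replace w2 with (vsub q (vsub q w2)); auto.
      unfold vadd, vsub; destruct w2; simpl; f_equal; ring. }
  intros x y o r2 Hx Hy N Ex Ey.
  destruct (Hd x y Hx Hy N) as [N1 _].
  destruct (Rdichotomy _ _ N1) as [L|L].
  - rewrite <- Ey. apply (Main y x); auto; [|congruence].
    unfold dot, vsub in *; simpl in *; lra.
  - rewrite <- Ex. apply (Main x y); auto; congruence.
Qed.

(** * Chains of tangent disks *)

Definition chord (p : nat -> pt) (i : nat) : pt := vsub (p (S i)) (p i).

(** Reflection in the line spanned by [c]. For a chord [c] of a circle it takes the vector from the
    first endpoint to the centre to the vector from the centre to the second endpoint. *)
Definition reflect (c v : pt) : pt := vsub (vscale (2 * dot c v / dot c c) c) v.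

(* [normal p v i] points from [p i] to the centre of the disk through [p i] and [p (S i)]
   and away from the centre of the previous disk, so that consecutive disks are tangent. *)
Fixpoint normal (p : nat -> pt) (v : pt) (i : nat) : pt :=
  match i with
  | O => v
  | S i => reflect (chord p i) (normal p v i)
  end.

(** The coefficient puts the point where the ray along the normal meets the perpendicular bisector
    of the chord. *)
Definition centre (p : nat -> pt) (v : pt) (i : nat) : pt :=
  vadd (p i) (vscale (dot (chord p i) (chord p i) / (2 * dot (chord p i) (normal p v i)))
                     (normal p v i)).

Definition radius2 (p : nat -> pt) (v : pt) (i : nat) : R := dist2 (p i) (centre p v i).

Definition in_disk (p : nat -> pt) (v : pt) (i : nat) (w : pt) : Prop :=
  dist2 w (centre p v i) < radius2 p v i.

(** Positivity puts each centre on the side its normal points to. The second clause separates disks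
    that are not cyclic neighbours: it implies that the centres are farther apart than the sum of
    the radii, without square roots. All conditions are strict, hence stable under perturbation. *)
Definition good_chain (n : nat) (p : nat -> pt) (v : pt) : Prop :=
  (forall i, (i < n)%nat -> 0 < dot (chord p i) (normal p v i)) /\
  (forall i j, (i < n)%nat -> (j < n)%nat -> (i + 2 <= j)%nat -> (j + 2 <= n + i)%nat ->
     2 * (radius2 p v i + radius2 p v j) < dist2 (centre p v i) (centre p v j)).

Lemma dot_self_pos c v : dot c v <> 0 -> 0 < dot c c.
Proof.
  intros H. destruct c as [a b], v as [x y]; unfold dot in *; simpl in *.
  destruct (Req_dec a 0) as [->|]; [|nra].
  destruct (Req_dec b 0) as [->|]; [|nra]. lra.
Qed.

Lemma centre_from_start p v i :
  vsub (centre p v i) (p i) =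
  vscale (dot (chord p i) (chord p i) / (2 * dot (chord p i) (normal p v i))) (normal p v i).
Proof. unfold centre, vsub, vadd, vscale; simpl; f_equal; ring. Qed.

Lemma centre_from_end p v i : dot (chord p i) (normal p v i) <> 0 ->
  vsub (centre p v i) (p (S i)) =
  vscale (- (dot (chord p i) (chord p i) / (2 * dot (chord p i) (normal p v i))))
         (normal p v (S i)).
Proof.
  intros H; pose proof (dot_self_pos _ _ H) as H'.
  simpl; unfold reflect, centre.
  set (N := normal p v i) in *; set (c := chord p i) in *.
  set (k := dot c N) in *; set (l := dot c c) in *.
  replace (p (S i)) with (vadd (p i) c)
    by (unfold c, chord, vadd, vsub; destruct (p (S i)); simpl; f_equal; ring).
  unfold vsub, vadd, vscale; simpl; f_equal; field; lra.
Qed.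

Lemma dist2_vsub w o x :
  dist2 w o - dist2 x o = dot (vsub w x) (vsub w x) - 2 * dot (vsub w x) (vsub o x).
Proof. unfold dist2, dot, vsub; simpl; ring. Qed.

Lemma dot_scale_r a k b : dot a (vscale k b) = k * dot a b.
Proof. unfold dot, vscale; simpl; ring. Qed.

Lemma dot_self_nonneg a : 0 <= dot a a.
Proof. unfold dot; nra. Qed.

Lemma radius2_end p v i : dot (chord p i) (normal p v i) <> 0 ->
  dist2 (p (S i)) (centre p v i) = radius2 p v i.
Proof.
  intros H. unfold radius2.
  apply Rminus_diag_uniq. rewrite dist2_vsub, centre_from_start, dot_scale_r.
  fold (chord p i). field. auto.
Qed.

(** An open disk lies strictly on its centre's side of each tangent line. With [in_disk_end], the
    common tangent at a shared vertex separates consecutive disks. *)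
Lemma in_disk_start p v i w : 0 < dot (chord p i) (normal p v i) ->
  in_disk p v i w -> 0 < dot (vsub w (p i)) (normal p v i).
Proof.
  intros H D. unfold in_disk, radius2 in D.
  pose proof (dist2_vsub w (centre p v i) (p i)) as E.
  rewrite centre_from_start, dot_scale_r in E.
  pose proof (dot_self_nonneg (vsub w (p i))).
  pose proof (dot_self_pos (chord p i) (normal p v i) ltac:(lra)) as C.
  set (s := _ / _) in E. assert (0 < s) by (apply Rdiv_lt_0_compat; lra). nra.
Qed.

Lemma in_disk_end p v i w : 0 < dot (chord p i) (normal p v i) ->
  in_disk p v i w -> dot (vsub w (p (S i))) (normal p v (S i)) < 0.
Proof.
  intros H D. unfold in_disk in D. rewrite <- radius2_end in D by lra.
  pose proof (dist2_vsub w (centre p v i) (p (S i))) as E.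
  rewrite centre_from_end, dot_scale_r in E by lra.
  pose proof (dot_self_nonneg (vsub w (p (S i)))).
  pose proof (dot_self_pos (chord p i) (normal p v i) ltac:(lra)) as C.
  set (s := _ / _) in E. assert (0 < s) by (apply Rdiv_lt_0_compat; lra). nra.
Qed.

(** By the parallelogram law the slack is the squared length of [2 w - a - b]. *)
Lemma dist2_sum w a b : dist2 a b <= 2 * (dist2 w a + dist2 w b).
Proof.
  unfold dist2.
  pose proof (Rle_0_sqr (2 * fst w - fst a - fst b)) as H1.
  pose proof (Rle_0_sqr (2 * snd w - snd a - snd b)) as H2.
  unfold Rsqr in *; lra.
Qed.

(** * Pigeonhole and disks sharing a witness *)

Lemma list_choice (A : Type) (Q : nat -> A -> Prop) (W : list A) n :
  (forall i, (i < n)%nat -> exists w, In w W /\ Q i w) ->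
  exists l, length l = n /\ incl l W /\
    forall i d, (i < n)%nat -> Q i (nth i l d).
Proof.
  induction n as [|n IH]; intros H.
  - exists nil; repeat split; [intros ? []|intros; lia].
  - destruct IH as (l & Ll & Il & Ql); [intros; apply H; lia|].
    destruct (H n) as (w & Hw & Qw); [lia|].
    exists (l ++ w :: nil); repeat split.
    + rewrite length_app; simpl; lia.
    + intros x Hx; apply in_app_or in Hx as [Hx|[<-|[]]]; auto.
    + intros i d Hi. destruct (Nat.eq_dec i n) as [->|E].
      * replace (nth n (l ++ w :: nil) d) with w by (rewrite <- Ll, nth_middle; auto). auto.
      * rewrite app_nth1 by lia; apply Ql; lia.
Qed.

Lemma pigeonhole (A : Type) (Q : nat -> A -> Prop) (W : list A) n :
  (forall i, (i < n)%nat -> exists w, In w W /\ Q i w) -> (length W < n)%nat ->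
  exists i j w, (i < j < n)%nat /\ In w W /\ Q i w /\ Q j w.
Proof.
  intros H L. destruct (list_choice A Q W n H) as (l & Ll & Il & Ql).
  assert (ND : ~ NoDup l) by (intros ND; pose proof (NoDup_incl_length ND Il); lia).
  destruct l as [|d l']; [simpl in Ll; lia|]. set (l := d :: l') in *.
  apply NNPP; intros N; apply ND, (NoDup_nth l d).
  assert (K : forall i j, (i < j < n)%nat -> nth i l d <> nth j l d).
  { intros i j Hij E; apply N. exists i, j, (nth i l d); repeat split; try lia.
    - apply Il, nth_In; lia.
    - apply Ql; lia.
    - rewrite E; apply Ql; lia. }
  intros i j Hi Hj E. rewrite Ll in Hi, Hj.
  destruct (lt_eq_lt_dec i j) as [[C|C]|C]; auto; exfalso.
  - apply (K i j); auto.
  - apply (K j i); auto.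
Qed.

(** Two disks share a witness. Tangency excludes consecutive ones and separation excludes the rest,
    except the first and last, whose tangent lines at [p 0] bound the wedge in the conclusion. *)
Lemma chain_overlap n p v W : (3 <= n)%nat -> p n = p O -> good_chain n p v ->
  (forall i, (i < n)%nat -> exists w, In w W /\ in_disk p v i w) -> (length W < n)%nat ->
  exists w, In w W /\ 0 < dot (vsub w (p O)) v /\ dot (vsub w (p O)) (normal p v n) < 0.
Proof.
  intros Hn Cl [G1 G2] H L.
  destruct (pigeonhole _ _ W n H L) as (i & j & w & Hij & Hw & Di & Dj).
  destruct (Nat.eq_dec j (S i)) as [->|E1].
  - pose proof (in_disk_end p v i w (G1 i ltac:(lia)) Di).
    pose proof (in_disk_start p v (S i) w (G1 (S i) ltac:(lia)) Dj). lra.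
  - destruct (le_lt_dec (j + 2) (n + i)) as [E2|E2].
    + pose proof (G2 i j ltac:(lia) ltac:(lia) ltac:(lia) E2).
      pose proof (dist2_sum w (centre p v i) (centre p v j)).
      unfold in_disk in *. lra.
    + assert (i = O) by lia. assert (S j = n) by lia. subst i.
      exists w; repeat split; auto.
      * apply (in_disk_start p v O w (G1 O ltac:(lia)) Di).
      * pose proof (in_disk_end p v j w (G1 j ltac:(lia)) Dj) as K.
        rewrite H1, Cl in K; exact K.
Qed.

(* The hypotheses make [v1, v2, v3, v4] wind once around the origin, so the origin is a convex
   combination of three of them. *)
Lemma no_common_half_plane v1 v2 v3 v4 x :
  0 < cross v1 v2 -> 0 < cross v2 v3 -> 0 < cross v3 v4 -> 0 < cross v4 v1 ->
  ~ (0 < dot x v1 /\ 0 < dot x v2 /\ 0 < dot x v3 /\ 0 < dot x v4).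
Proof.
  intros H1 H2 H3 H4 (X1 & X2 & X3 & X4).
  (* The linear relation between three plane vectors. The sign of [cross v1 v3] decides which triple
     has nonnegative coefficients. *)
  assert (I : forall a b c, dot x a * cross b c + dot x b * cross c a + dot x c * cross a b = 0)
    by (intros; unfold dot, cross; ring).
  destruct (Rle_dec (cross v1 v3) 0) as [L|L].
  - pose proof (I v1 v2 v3).
    assert (0 <= cross v3 v1) by (unfold cross in *; lra). nra.
  - pose proof (I v1 v3 v4). nra.
Qed.

(** * Limits of chains *)

Definition tends (u : nat -> pt) (l : pt) : Prop :=
  is_lim_seq (fun k => fst (u k)) (fst l) /\ is_lim_seq (fun k => snd (u k)) (snd l).

Lemma tends_const l : tends (fun _ => l) l.
Proof. split; apply is_lim_seq_const. Qed.

Lemma tends_vadd u a u' a' : tends u a -> tends u' a' ->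
  tends (fun k => vadd (u k) (u' k)) (vadd a a').
Proof. intros [H1 H2] [H3 H4]; split; simpl; apply is_lim_seq_plus'; auto. Qed.

Lemma tends_vsub u a u' a' : tends u a -> tends u' a' ->
  tends (fun k => vsub (u k) (u' k)) (vsub a a').
Proof. intros [H1 H2] [H3 H4]; split; simpl; apply is_lim_seq_minus'; auto. Qed.

Lemma tends_vscale s (t : R) u a : is_lim_seq s t -> tends u a ->
  tends (fun k => vscale (s k) (u k)) (vscale t a).
Proof. intros H [H1 H2]; split; simpl; apply is_lim_seq_mult'; auto. Qed.

Lemma lim_dot u a u' a' : tends u a -> tends u' a' ->
  is_lim_seq (fun k => dot (u k) (u' k)) (dot a a').
Proof.
  intros [H1 H2] [H3 H4]; apply is_lim_seq_plus'; apply is_lim_seq_mult'; auto.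
Qed.

Lemma lim_cross u a u' a' : tends u a -> tends u' a' ->
  is_lim_seq (fun k => cross (u k) (u' k)) (cross a a').
Proof.
  intros [H1 H2] [H3 H4]; apply is_lim_seq_minus'; apply is_lim_seq_mult'; auto.
Qed.

Lemma lim_dist2 u a u' a' : tends u a -> tends u' a' ->
  is_lim_seq (fun k => dist2 (u k) (u' k)) (dist2 a a').
Proof.
  intros [H1 H2] [H3 H4]; apply is_lim_seq_plus'; apply is_lim_seq_mult';
    apply is_lim_seq_minus'; auto.
Qed.

Lemma lim_scale (s : nat -> R) (t : R) c : is_lim_seq s t -> is_lim_seq (fun k => c * s k) (c * t).
Proof. intros; apply is_lim_seq_mult'; auto; apply is_lim_seq_const. Qed.

Lemma eventually_lt (s s' : nat -> R) (l l' : R) :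
  is_lim_seq s l -> is_lim_seq s' l' -> l < l' -> eventually (fun k => s k < s' k).
Proof.
  intros H H' L.
  set (d := (l' - l) / 2). assert (Hd : 0 < d) by (unfold d; lra).
  apply is_lim_seq_spec in H. apply is_lim_seq_spec in H'.
  specialize (H (mkposreal d Hd)). specialize (H' (mkposreal d Hd)). simpl in *.
  generalize (filter_and _ _ H H'). apply filter_imp; intros k [K1 K2].
  apply Rabs_lt_between' in K1; apply Rabs_lt_between' in K2. unfold d in *; lra.
Qed.

Lemma eventually_bounded_forall (Q : nat -> nat -> Prop) n :
  (forall i, (i < n)%nat -> eventually (Q i)) ->
  eventually (fun k => forall i, (i < n)%nat -> Q i k).
Proof.
  induction n as [|n IH]; intros H.
  - apply filter_forall; intros; lia.
  - generalize (filter_and _ _ (IH (fun i Hi => H i (Nat.lt_lt_succ_r _ _ Hi))) (H n (Nat.lt_succ_diag_r n))).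
    apply filter_imp; intros k [K1 K2] i Hi.
    destruct (Nat.eq_dec i n) as [->|]; auto; apply K1; lia.
Qed.

Lemma eventually_exists (Q : nat -> Prop) : eventually Q -> exists k, Q k.
Proof. intros [N H]; exists N; apply H; lia. Qed.

Lemma chord_lim n (pk : nat -> nat -> pt) p i :
  (forall i, (i <= n)%nat -> tends (fun k => pk k i) (p i)) ->
  (i < n)%nat -> tends (fun k => chord (pk k) i) (chord p i).
Proof. intros H Hi; apply tends_vsub; apply H; lia. Qed.

Lemma normal_lim n (pk : nat -> nat -> pt) p vk v i :
  (forall i, (i <= n)%nat -> tends (fun k => pk k i) (p i)) -> tends vk v ->
  (forall j, (j < i)%nat -> dot (chord p j) (normal p v j) <> 0) ->
  (i <= n)%nat -> tends (fun k => normal (pk k) (vk k) i) (normal p v i).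
Proof.
  intros pk_lim vk_lim.
  induction i as [|i IH]; intros H Hi; [exact vk_lim|]; simpl.
  assert (IH' := IH (fun j Hj => H j ltac:(lia)) ltac:(lia)).
  assert (C := chord_lim n pk p i pk_lim ltac:(lia)).
  apply tends_vsub; auto. apply tends_vscale; auto.
  apply is_lim_seq_div'.
  - apply lim_scale, lim_dot; auto.
  - apply lim_dot; auto.
  - pose proof (dot_self_pos _ _ (H i ltac:(lia))); lra.
Qed.

(** Normals, centres and radii are continuous because no denominator vanishes in the limit, and
    finitely many strict inequalities persist. It serves both to tilt the starting direction and to
    perturb the polygon. *)
Lemma good_chain_eventually n (pk : nat -> nat -> pt) p vk v :
  (forall i, (i <= n)%nat -> tends (fun k => pk k i) (p i)) -> tends vk v ->
  good_chain n p v -> eventually (fun k => good_chain n (pk k) (vk k)).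
Proof.
  intros pk_lim vk_lim [G1 G2].
  assert (NZ : forall j, (j < n)%nat -> dot (chord p j) (normal p v j) <> 0)
    by (intros j Hj; specialize (G1 j Hj); lra).
  assert (NL : forall i, (i <= n)%nat -> tends (fun k => normal (pk k) (vk k) i) (normal p v i))
    by (intros i Hi; apply (normal_lim n); auto; intros; apply NZ; lia).
  assert (CL : forall i, (i < n)%nat -> tends (fun k => centre (pk k) (vk k) i) (centre p v i)).
  { intros i Hi. assert (C := chord_lim n pk p i pk_lim Hi).
    apply tends_vadd; [apply pk_lim; lia|]. apply tends_vscale; [|apply NL; lia].
    apply is_lim_seq_div'.
    - apply lim_dot; auto.
    - apply lim_scale, lim_dot; auto. apply NL; lia.
    - specialize (NZ i Hi); lra. }
  assert (RL : forall i, (i < n)%nat ->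
            is_lim_seq (fun k => radius2 (pk k) (vk k) i) (radius2 p v i))
    by (intros i Hi; apply lim_dist2; [apply pk_lim; lia | apply CL; auto]).
  apply filter_and.
  - apply eventually_bounded_forall; intros i Hi.
    apply (eventually_lt _ _ 0 (dot (chord p i) (normal p v i))); auto.
    + apply is_lim_seq_const.
    + apply lim_dot; [apply (chord_lim n); auto | apply NL; lia].
  - assert (E : eventually (fun k => forall i, (i < n)%nat -> forall j, (j < n)%nat ->
       (i + 2 <= j)%nat -> (j + 2 <= n + i)%nat ->
       2 * (radius2 (pk k) (vk k) i + radius2 (pk k) (vk k) j)
         < dist2 (centre (pk k) (vk k) i) (centre (pk k) (vk k) j))).
    { apply eventually_bounded_forall; intros i Hi.
      apply eventually_bounded_forall; intros j Hj.
      destruct (classic ((i + 2 <= j)%nat /\ (j + 2 <= n + i)%nat)) as [[A1 A2]|A];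
        [|apply filter_forall; tauto].
      assert (E := eventually_lt _ _ _ _
        (lim_scale _ _ 2 (is_lim_seq_plus' _ _ _ _ (RL i Hi) (RL j Hj)))
        (lim_dist2 _ _ _ _ (CL i Hi) (CL j Hj)) (G2 i j Hi Hj A1 A2)).
      revert E; apply filter_imp; auto. }
    revert E; apply filter_imp; intros k K i j Hi Hj; apply K; auto.
Qed.

(** * The regular polygon *)

Definition vertex (a : R) (i : nat) : pt := (cos (INR i * a), sin (INR i * a)).
Definition tangent (a : R) (i : nat) : pt := (- sin (INR i * a), cos (INR i * a)).

Lemma cos_S a i : cos (INR (S i) * a) = cos (INR i * a) * cos a - sin (INR i * a) * sin a.
Proof. rewrite S_INR, Rmult_plus_distr_r, Rmult_1_l; apply cos_plus. Qed.

Lemma sin_S a i : sin (INR (S i) * a) = sin (INR i * a) * cos a + cos (INR i * a) * sin a.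
Proof. rewrite S_INR, Rmult_plus_distr_r, Rmult_1_l; apply sin_plus. Qed.

Lemma cos2_sin2 x : cos x * cos x + sin x * sin x = 1.
Proof. pose proof (sin2_cos2 x); unfold Rsqr in *; lra. Qed.

Lemma vertex_chord a i : chord (vertex a) i =
  (cos (INR i * a) * (cos a - 1) - sin (INR i * a) * sin a,
   sin (INR i * a) * (cos a - 1) + cos (INR i * a) * sin a).
Proof.
  unfold chord, vsub, vertex; cbn [fst snd].
  rewrite cos_S, sin_S; f_equal; ring.
Qed.

Lemma vertex_chord_norm a i : dot (chord (vertex a) i) (chord (vertex a) i) = 2 * (1 - cos a).
Proof.
  rewrite vertex_chord; unfold dot; cbn [fst snd].
  pose proof (cos2_sin2 a) as E; pose proof (cos2_sin2 (INR i * a)) as F.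
  set (c := cos (INR i * a)) in *; set (s := sin (INR i * a)) in *.
  transitivity ((c * c + s * s) * ((cos a - 1) * (cos a - 1) + sin a * sin a)); [ring|].
  rewrite F. lra.
Qed.

Lemma vertex_chord_dot a i t :
  dot (chord (vertex a) i) (vadd (tangent a i) (vscale t (vertex a i))) =
  sin a - t * (1 - cos a).
Proof.
  rewrite vertex_chord; unfold dot, vadd, vscale, tangent, vertex; cbn [fst snd].
  pose proof (cos2_sin2 (INR i * a)) as F.
  set (c := cos (INR i * a)) in *; set (s := sin (INR i * a)) in *.
  transitivity ((c * c + s * s) * (sin a - t * (1 - cos a))); [ring|].
  rewrite F. ring.
Qed.

(** A chord makes equal angles with the tangents at its ends, so the reflection carries tangent to
    tangent and, reversing orientation, flips the radial part. *)
Lemma vertex_reflect a i t : cos a <> 1 ->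
  reflect (chord (vertex a) i) (vadd (tangent a i) (vscale t (vertex a i))) =
  vadd (tangent a (S i)) (vscale (- t) (vertex a (S i))).
Proof.
  intros H; unfold reflect.
  rewrite vertex_chord_dot, vertex_chord_norm, vertex_chord.
  (* This is the cotangent of [a / 2]; [K1] and [K2] are its half-angle relations. *)
  set (k := sin a / (1 - cos a)).
  assert (K1 : k * (1 - cos a) = sin a) by (unfold k; field; lra).
  assert (K2 : k * sin a = 1 + cos a).
  { pose proof (cos2_sin2 a) as E. unfold k.
    apply Rmult_eq_reg_l with (1 - cos a); [|lra]. field_simplify; [|lra]. nra. }
  replace (2 * (sin a - t * (1 - cos a)) / (2 * (1 - cos a))) with (k - t)
    by (unfold k; field; lra).
  unfold vadd, vsub, vscale, tangent, vertex; cbn [fst snd].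
  rewrite cos_S, sin_S.
  set (c := cos (INR i * a)) in *; set (s := sin (INR i * a)) in *.
  f_equal.
  - transitivity (- c * (k * (1 - cos a)) - s * (k * sin a)
      - t * (c * (cos a - 1) - s * sin a) + s - t * c); [ring|].
    rewrite K1, K2; ring.
  - transitivity (- s * (k * (1 - cos a)) + c * (k * sin a)
      - t * (s * (cos a - 1) + c * sin a) - c - t * s); [ring|].
    rewrite K1, K2; ring.
Qed.

Lemma vertex_normal a t i : cos a <> 1 ->
  normal (vertex a) (vadd (tangent a 0) (vscale t (vertex a 0))) i =
  vadd (tangent a i) (vscale ((-1) ^ i * t) (vertex a i)).
Proof.
  intros H; induction i as [|i IH].
  - cbn [normal pow]; rewrite Rmult_1_l; reflexivity.
  - cbn [normal]; rewrite IH, vertex_reflect by auto.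
    f_equal; f_equal; simpl; ring.
Qed.

Lemma vadd_scale0 p q : vadd p (vscale 0 q) = p.
Proof. destruct p; unfold vadd, vscale; simpl; f_equal; ring. Qed.

Lemma vertex_normal_tangent a i : cos a <> 1 ->
  normal (vertex a) (tangent a 0) i = tangent a i.
Proof.
  intros H. pose proof (vertex_normal a 0 i H) as E.
  rewrite Rmult_0_r, !vadd_scale0 in E; exact E.
Qed.

Lemma polygon_angle n : (3 <= n)%nat -> 0 < 2 * PI / INR n < PI.
Proof.
  intros Hn. apply le_INR in Hn. simpl in Hn.
  pose proof PI_RGT_0. split.
  - apply Rdiv_lt_0_compat; lra.
  - apply Rmult_lt_reg_r with (INR n); [lra|]. field_simplify; nra.
Qed.

(** The angle lies strictly between [a] and [2 * PI - a], where [a] is one step; beyond [PI] the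
    symmetry of the cosine is used. *)
Lemma cos_polygon_lt n d : (3 <= n)%nat -> (2 <= d)%nat -> (d + 2 <= n)%nat ->
  cos (INR d * (2 * PI / INR n)) < cos (2 * PI / INR n).
Proof.
  intros Hn Hd Hd'. pose proof (polygon_angle n Hn) as [A1 A2].
  set (a := 2 * PI / INR n) in *.
  assert (Hn0 : 0 < INR n) by (apply lt_0_INR; lia).
  assert (Ea : INR n * a = 2 * PI) by (unfold a; field; lra).
  apply le_INR in Hd, Hd'. rewrite plus_INR in Hd'. simpl in Hd, Hd'.
  assert (L1 : a < INR d * a) by nra.
  assert (L2 : INR d * a < 2 * PI - a) by nra.
  destruct (Rle_dec (INR d * a) PI).
  - apply cos_decreasing_1; lra.
  - replace (cos (INR d * a)) with (cos (2 * PI - INR d * a)).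
    + apply cos_decreasing_1; lra.
    + rewrite cos_minus, cos_2PI, sin_2PI; ring.
Qed.

(** All radii equal [g], the tangent of [a / 2], and the centres form a regular polygon with squared
    circumradius [1 + g * g]. Neighbouring disks being tangent, [2 * (1 + g * g) * (1 - cos a)] is
    [4 * (g * g)]; non-neighbours have a smaller cosine and so lie farther apart. *)
Lemma polygon_good n : (3 <= n)%nat ->
  good_chain n (vertex (2 * PI / INR n)) (tangent (2 * PI / INR n) 0).
Proof.
  intros Hn; pose proof (polygon_angle n Hn) as [A1 A2].
  pose proof (cos_polygon_lt n) as CL.
  set (a := 2 * PI / INR n) in *.
  assert (S0 : 0 < sin a) by (apply sin_gt_0; lra).
  pose proof (cos2_sin2 a) as E.
  assert (C1 : cos a < 1) by nra.
  assert (C2 : -1 < cos a) by nra.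
  assert (D : forall i, dot (chord (vertex a) i) (tangent a i) = sin a).
  { intros i; pose proof (vertex_chord_dot a i 0) as F. rewrite vadd_scale0 in F.
    rewrite F; ring. }
  split.
  - intros i _. rewrite vertex_normal_tangent, D by lra; auto.
  - intros i j Hi Hj H1 H2.
    set (g := 2 * (1 - cos a) / (2 * sin a)).
    assert (Ce : forall i, centre (vertex a) (tangent a 0) i
                   = vadd (vertex a i) (vscale g (tangent a i))).
    { intros m; unfold centre. rewrite vertex_normal_tangent, D, vertex_chord_norm by lra.
      reflexivity. }
    assert (Ra : forall i, radius2 (vertex a) (tangent a 0) i = g * g).
    { intros m; unfold radius2; rewrite Ce.
      unfold dist2, vadd, vscale, vertex, tangent; cbn [fst snd].
      pose proof (cos2_sin2 (INR m * a)) as F.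
      set (c := cos (INR m * a)) in *; set (s := sin (INR m * a)) in *.
      transitivity (g * g * (c * c + s * s)); [ring|]. rewrite F; ring. }
    rewrite !Ra, !Ce.
    specialize (CL (j - i)%nat Hn ltac:(lia) ltac:(lia)).
    rewrite minus_INR in CL by lia.
    rewrite Rmult_minus_distr_r, cos_minus in CL.
    unfold dist2, vadd, vscale, vertex, tangent; cbn [fst snd].
    pose proof (cos2_sin2 (INR i * a)) as F1; pose proof (cos2_sin2 (INR j * a)) as F2.
    set (ci := cos (INR i * a)) in *; set (si := sin (INR i * a)) in *.
    set (cj := cos (INR j * a)) in *; set (sj := sin (INR j * a)) in *.
    match goal with |- _ < ?r =>
      replace r with ((1 + g * g) * ((ci * ci + si * si) + (cj * cj + sj * sj)
                                     - 2 * (cj * ci + sj * si))) by ring end.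
    rewrite F1, F2.
    assert (G : g * g * (1 + cos a) = 1 - cos a).
    { unfold g. apply Rmult_eq_reg_l with (sin a * sin a); [|nra].
      field_simplify; [|lra]. nra. }
    assert (0 <= g * g) by nra.
    set (x := cj * ci + sj * si) in *.
    assert (0 < (1 + g * g) * (cos a - x)) by (apply Rmult_lt_0_compat; lra).
    nra.
Qed.

Lemma vertex_n n : (0 < n)%nat -> vertex (2 * PI / INR n) n = vertex (2 * PI / INR n) 0.
Proof.
  intros Hn; apply lt_0_INR in Hn; unfold vertex.
  replace (INR n * (2 * PI / INR n)) with (2 * PI) by (field; lra).
  simpl (INR 0); rewrite Rmult_0_l, cos_2PI, sin_2PI, cos_0, sin_0; reflexivity.
Qed.

Lemma tangent_n n : (0 < n)%nat -> tangent (2 * PI / INR n) n = tangent (2 * PI / INR n) 0.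
Proof.
  intros Hn; apply lt_0_INR in Hn; unfold tangent.
  replace (INR n * (2 * PI / INR n)) with (2 * PI) by (field; lra).
  simpl (INR 0); rewrite Rmult_0_l, cos_2PI, sin_2PI, cos_0, sin_0; reflexivity.
Qed.

(** * The lower bound *)

(** A single witness on the line through [p] and [q] breaks general position or is an endpoint,
    which no open disk here contains; off that line it lies on the boundary of one of the disks. *)
Lemma stD_lower_two : exists P, gp_set 2 P /\ stD_ge P 2.
Proof.
  set (p := (0, 0) : pt); set (q := (2, 0) : pt).
  assert (pq : p <> q) by (unfold p, q; intros E; injection E; lra).
  exists (p :: q :: nil); split.
  - split; [|split; [reflexivity|]].
    + repeat constructor; simpl; intuition.
    + split.
      * intros a b c [<-|[<-|[]]] [<-|[<-|[]]] [<-|[<-|[]]]; congruence.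
      * intros a b c d [<-|[<-|[]]] [<-|[<-|[]]] [<-|[<-|[]]]; congruence.
  - intros W (_ & [G _] & St).
    destruct W as [|w [|w' W]]; [| |simpl; lia]; exfalso.
    + destruct (St p q (1, 0) 1) as (w & [] & _); auto;
        try (unfold dist2, p, q; simpl; ring); simpl; auto.
    + assert (St' : forall t, dist2 w (1, t) < 1 + t * t).
      { intros t. destruct (St p q (1, t) (1 + t * t)) as (x & [<-|[]] & H); auto;
          try (unfold dist2, p, q; simpl; ring); simpl; auto. }
      destruct (Req_dec (snd w) 0) as [Z|Z].
      * assert (w <> p).
        { intros ->. specialize (St' 0). unfold dist2, p in St'; simpl in St'; lra. }
        assert (w <> q).
        { intros ->. specialize (St' 0). unfold dist2, q in St'; simpl in St'; lra. }
        apply (G p q w); simpl; auto.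
        unfold collinear, p, q; simpl; rewrite Z; ring.
      (* The height of the centre of the circle through [p], [q] and [w]. *)
      * specialize (St' (((fst w - 1) * (fst w - 1) + snd w * snd w - 1) / (2 * snd w))).
        set (t := _ / _) in St'.
        assert (2 * snd w * t = (fst w - 1) * (fst w - 1) + snd w * snd w - 1)
          by (unfold t; field; auto).
        unfold dist2 in St'; simpl in St'; lra.
Qed.

(** * Polygons in general position converging to a given one *)

Lemma lim_inv_S : is_lim_seq (fun k => / (INR k + 1)) 0.
Proof.
  apply is_lim_seq_spec; intros eps.
  destruct (archimed_cor1 eps (cond_pos eps)) as (N & HN & N0).
  exists N; intros k Hk. apply le_INR in Hk. apply lt_0_INR in N0.
  rewrite Rminus_0_r, Rabs_pos_eq by (left; apply Rinv_0_lt_compat; lra).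
  apply Rle_lt_trans with (/ INR N); auto. apply Rinv_le_contravar; lra.
Qed.

Lemma tends_close u l : (forall k, close (/ (INR k + 1)) (u k) l) -> tends u l.
Proof.
  assert (X : forall (s : nat -> R) (t : R), (forall k, Rabs (s k - t) < / (INR k + 1)) ->
            is_lim_seq s t).
  { intros s t H. apply is_lim_seq_spec; intros eps.
    pose proof (proj2 (is_lim_seq_spec _ _) lim_inv_S eps) as L.
    revert L; apply filter_imp; intros k Hk.
    rewrite Rminus_0_r in Hk. specialize (H k).
    pose proof (Rle_abs (/ (INR k + 1))). lra. }
  intros H; split; apply X; intros k; apply H.
Qed.

Lemma Forall2_nth_close e W T d i :
  Forall2 (close e) W T -> (i < length T)%nat -> close e (nth i W d) (nth i T d).
Proof.
  intros F; revert i; induction F; intros [|i] Hi; simpl in *; try lia; auto.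
  apply IHF; lia.
Qed.

Lemma general_position_sequence n p0 : (0 < n)%nat -> p0 n = p0 O ->
  exists pk : nat -> nat -> pt,
    (forall k, gp_set n (map (pk k) (seq 0 n)) /\ pk k n = pk k O) /\
    (forall i, (i <= n)%nat -> tends (fun k => pk k i) (p0 i)).
Proof.
  intros Hn E.
  assert (X : forall k : nat, exists p : nat -> pt,
     (gp_set n (map p (seq 0 n)) /\ p n = p O) /\
     forall i, (i <= n)%nat -> close (/ (INR k + 1)) (p i) (p0 i)).
  { intros k. set (e := / (INR k + 1)).
    assert (He : 0 < e) by (apply Rinv_0_lt_compat; pose proof (pos_INR k); lra).
    destruct (general_position_perturb (map p0 (seq 0 n)) nil e He) as (W & F & ND & _ & G).
    { split; intros a b c; intros; contradiction. }
    assert (LW : length W = n) by (rewrite (Forall2_length F), length_map, length_seq; auto).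
    set (d := p0 O).
    (* Index [n] reads entry [0], so the perturbed polygon closes up exactly. *)
    exists (fun i => nth (if Nat.eq_dec i n then O else i) W d).
    assert (EW : map (fun i => nth (if Nat.eq_dec i n then O else i) W d) (seq 0 n) = W).
    { apply nth_ext with d d; rewrite length_map, length_seq; auto.
      intros i Hi. set (f := fun i => nth (if Nat.eq_dec i n then O else i) W d).
      rewrite (nth_indep _ d (f O)) by (rewrite length_map, length_seq; auto).
      rewrite map_nth, seq_nth by auto. unfold f; simpl.
      destruct (Nat.eq_dec i n); [lia | auto]. }
    assert (CW : forall i, (i < n)%nat -> close e (nth i W d) (p0 i)).
    { intros i Hi.
      pose proof (Forall2_nth_close e W _ d i F) as K.
      rewrite length_map, length_seq in K. specialize (K Hi).
      unfold d in K at 2; rewrite map_nth, seq_nth in K by auto. exact K. }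
    split; [split|].
    - rewrite EW; split; [|split]; auto.
    - destruct (Nat.eq_dec n n); [|congruence]. destruct (Nat.eq_dec 0 n); auto.
    - intros i Hi; simpl. destruct (Nat.eq_dec i n) as [->|N].
      + rewrite E; apply CW; auto.
      + apply CW; lia. }
  apply functional_choice in X as (pk & Hpk).
  exists pk; split.
  - intros k; apply Hpk.
  - intros i Hi; apply tends_close; intros k; apply Hpk; auto.
Qed.

Lemma chain_stabbed n p v W : p n = p O -> good_chain n p v ->
  stabs_all_disks (map p (seq 0 n)) W ->
  forall i, (i < n)%nat -> exists w, In w W /\ in_disk p v i w.
Proof.
  intros Cl [G _] St i Hi. specialize (G i Hi).
  assert (I : forall j, (j < n)%nat -> In (p j) (map p (seq 0 n)))
    by (intros j Hj; apply in_map, in_seq; lia).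
  apply (St (p i) (p (S i)) (centre p v i)); auto.
  - destruct (Nat.eq_dec (S i) n) as [->|]; [rewrite Cl|]; apply I; lia.
  - intros E. unfold chord in G; rewrite <- E in G.
    unfold dot, vsub in G; simpl in G; lra.
  - apply radius2_end; lra.
Qed.

Lemma reflect_matrix c : 0 < dot c c -> exists a b, a * a + b * b = 1 /\
  forall v, reflect c v = (a * fst v + b * snd v, b * fst v - a * snd v).
Proof.
  destruct c as [x y]; unfold reflect, dot, vsub, vscale; simpl; intros H.
  exists ((x * x - y * y) / (x * x + y * y)), (2 * x * y / (x * x + y * y)); split.
  - field; lra.
  - intros v; f_equal; field; lra.
Qed.

(** A composite of [m] reflections: a rotation for even [m], a reflection for odd [m], with a matrix
    independent of [v]. *)
Lemma normal_matrix p m : (forall i, (i < m)%nat -> 0 < dot (chord p i) (chord p i)) ->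
  exists a b, a * a + b * b = 1 /\
    forall v, normal p v m = if Nat.even m then (a * fst v - b * snd v, b * fst v + a * snd v)
                             else (a * fst v + b * snd v, b * fst v - a * snd v).
Proof.
  induction m as [|m IH]; intros H.
  - exists 1, 0; split; [ring|]. intros [x y]; simpl; f_equal; ring.
  - destruct IH as (a & b & E & F); [intros; apply H; lia|].
    destruct (reflect_matrix (chord p m) (H m ltac:(lia))) as (a' & b' & E' & F').
    cbn [normal].
    rewrite Nat.even_succ, <- Nat.negb_even.
    destruct (Nat.even m).
    + exists (a' * a + b' * b), (b' * a - a' * b); split.
      * transitivity ((a * a + b * b) * (a' * a' + b' * b')); [ring | rewrite E, E'; ring].
      * intros v; rewrite F', F; simpl; f_equal; ring.
    + exists (a' * a + b' * b), (b' * a - a' * b); split.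
      * transitivity ((a * a + b * b) * (a' * a' + b' * b')); [ring | rewrite E, E'; ring].
      * intros v; rewrite F', F; simpl; f_equal; ring.
Qed.

(* An odd product of reflections is a reflection, whose axis is spanned by [v + R v]. *)
Lemma normal_odd_fixed n p v : Nat.even n = false ->
  (forall i, (i < n)%nat -> 0 < dot (chord p i) (chord p i)) ->
  normal p (vscale (/ 2) (vadd v (normal p v n))) n = vscale (/ 2) (vadd v (normal p v n)).
Proof.
  intros O H. destruct (normal_matrix p n H) as (a & b & E & F).
  rewrite O in F. rewrite !F. destruct v as [x y]; unfold vscale, vadd; simpl.
  f_equal.
  - transitivity (/ 2 * (a * x + b * y + (a * a + b * b) * x)); [ring | rewrite E; ring].
  - transitivity (/ 2 * (b * x - a * y + (a * a + b * b) * y)); [ring | rewrite E; ring].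
Qed.

Lemma stD_lower_odd n : (3 <= n)%nat -> Nat.even n = false ->
  exists P, gp_set n P /\ stD_ge P n.
Proof.
  intros Hn Odd. pose proof (polygon_good n Hn) as G.
  pose proof (polygon_angle n Hn) as [A1 A2].
  pose proof (vertex_n n ltac:(lia)) as Vn; pose proof (tangent_n n ltac:(lia)) as Tn.
  set (a := 2 * PI / INR n) in *.
  assert (Ca : cos a <> 1).
  { pose proof (sin_gt_0 a A1 A2); pose proof (cos2_sin2 a); nra. }
  destruct (general_position_sequence n (vertex a) ltac:(lia) Vn) as (pk & Hpk & Lim).
  set (T := tangent a 0) in *.
  assert (NL : tends (fun k => normal (pk k) T n) (normal (vertex a) T n)).
  { apply (normal_lim n); auto using tends_const.
    intros j Hj; pose proof (proj1 G j Hj); lra. }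
  unfold T in NL at 2; rewrite vertex_normal_tangent, Tn in NL by auto. fold T in NL.
  (* The direction fixed by the perturbed chain tends to [T], since the regular polygon returns [T]
     to itself; so the chain is eventually good. *)
  assert (VL : tends (fun k => vscale (/ 2) (vadd T (normal (pk k) T n))) T).
  { assert (E : vscale (/ 2) (vadd T T) = T)
      by (unfold vscale, vadd; destruct T; simpl; f_equal; field).
    apply (eq_ind _ (tends _)) with (2 := E).
    apply tends_vscale; [apply is_lim_seq_const|].
    apply tends_vadd; auto using tends_const. }
  destruct (eventually_exists _ (good_chain_eventually n pk (vertex a) _ T Lim VL G)) as (k & Gk).
  destruct (Hpk k) as [GP Cl].
  exists (map (pk k) (seq 0 n)); split; auto.
  intros W (_ & _ & St). apply Nat.nlt_ge; intros L.
  destruct (chain_overlap n (pk k) _ W Hn Cl Gk (chain_stabbed n _ _ W Cl Gk St) L)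
    as (w & _ & H1 & H2).
  (* The chain closes up, so [H1] and [H2] put [w] strictly on both sides of one line. *)
  rewrite normal_odd_fixed in H2; auto; [lra|].
  intros i Hi. apply dot_self_pos with (normal (pk k) (vscale (/ 2) (vadd T (normal (pk k) T n))) i).
  pose proof (proj1 Gk i Hi); lra.
Qed.

Lemma eventually_pos (s : nat -> R) (l : R) :
  is_lim_seq s l -> 0 < l -> eventually (fun k => 0 < s k).
Proof. intros H L; apply (eventually_lt (fun _ => 0) s 0 l); auto; apply is_lim_seq_const. Qed.

Lemma stD_lower_even n : (3 <= n)%nat -> Nat.even n = true ->
  exists P, gp_set n P /\ stD_ge P n.
Proof.
  intros Hn Ev. pose proof (polygon_good n Hn) as G.
  pose proof (polygon_angle n Hn) as [A1 A2].
  pose proof (vertex_n n ltac:(lia)) as Vn; pose proof (tangent_n n ltac:(lia)) as Tn.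
  set (a := 2 * PI / INR n) in *.
  assert (Ca : cos a <> 1).
  { pose proof (sin_gt_0 a A1 A2); pose proof (cos2_sin2 a); nra. }
  (* [n] distinct tilts of the tangent; a large [h] makes all of them small enough for good
     chains. *)
  set (dir := fun (h j : nat) => vadd (tangent a 0) (vscale (INR j * / (INR h + 1)) (vertex a 0))).
  assert (Hh : exists h, forall j, (j < n)%nat -> good_chain n (vertex a) (dir h j)).
  { apply eventually_exists, (eventually_bounded_forall (fun j h => good_chain n (vertex a) (dir h j))).
    intros j Hj. apply (good_chain_eventually n (fun _ => vertex a) (vertex a)
      (fun h => dir h j) (tangent a 0)); auto.
    - intros; apply tends_const.
    - assert (E : vadd (tangent a 0) (vscale (INR j * 0) (vertex a 0)) = tangent a 0)
        by (rewrite Rmult_0_r; apply vadd_scale0).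
      apply (eq_ind _ (tends _)) with (2 := E).
      apply tends_vadd; [apply tends_const|]. apply tends_vscale; [|apply tends_const].
      apply lim_scale, lim_inv_S. }
  destruct Hh as (h & Gh). set (v := dir h) in *.
  (* For even [n] the radial part is flipped an even number of times, so every direction returns to
     itself. *)
  assert (Fix : forall j, normal (vertex a) (v j) n = v j).
  { intros j; unfold v, dir; rewrite vertex_normal, Vn, Tn by auto.
    apply Nat.even_spec in Ev as [m ->]. rewrite pow_1_even, Rmult_1_l; reflexivity. }
  assert (X : forall i j, (i < j)%nat -> 0 < cross (v j) (v i)).
  { intros i j Hij. apply lt_INR in Hij.
    assert (0 < / (INR h + 1)) by (apply Rinv_0_lt_compat; pose proof (pos_INR h); lra).
    unfold v, dir, cross, vadd, vscale, tangent, vertex; cbn [fst snd].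
    simpl (INR 0); rewrite Rmult_0_l, sin_0, cos_0. nra. }
  destruct (general_position_sequence n (vertex a) ltac:(lia) Vn) as (pk & Hpk & Lim).
  assert (NL : forall j, (j < n)%nat -> tends (fun k => normal (pk k) (v j) n) (v j)).
  { intros j Hj. apply (eq_ind _ (tends _)) with (2 := Fix j).
    apply (normal_lim n pk _ (fun _ => v j)); auto using tends_const.
    intros i Hi; pose proof (proj1 (Gh j Hj) i Hi); lra. }
  assert (E1 : eventually (fun k => forall j, (j < n)%nat -> good_chain n (pk k) (v j))).
  { apply eventually_bounded_forall; intros j Hj.
    apply (good_chain_eventually n pk (vertex a) (fun _ => v j) (v j));
      auto using tends_const. }
  (* The returned normals stay so near the [v j] that the cyclic order of both families is kept;
     this makes the wedges at [pk k 0] disjoint. *)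
  assert (E2 : eventually (fun k => forall j, (j < n)%nat -> forall i, (i < n)%nat -> (i < j)%nat ->
     0 < cross (normal (pk k) (v j) n) (v i) /\ 0 < cross (v j) (normal (pk k) (v i) n) /\
     0 < cross (normal (pk k) (v j) n) (normal (pk k) (v i) n))).
  { apply eventually_bounded_forall; intros j Hj; apply eventually_bounded_forall; intros i Hi.
    destruct (lt_dec i j) as [Hij|Hij]; [|apply filter_forall; tauto].
    specialize (X i j Hij).
    assert (Q1 := eventually_pos _ _ (lim_cross _ _ _ _ (NL j Hj) (tends_const (v i))) X).
    assert (Q2 := eventually_pos _ _ (lim_cross _ _ _ _ (tends_const (v j)) (NL i Hi)) X).
    assert (Q3 := eventually_pos _ _ (lim_cross _ _ _ _ (NL j Hj) (NL i Hi)) X).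
    generalize (filter_and _ _ Q1 (filter_and _ _ Q2 Q3)). apply filter_imp; tauto. }
  destruct (eventually_exists _ (filter_and _ _ E1 E2)) as (k & Gk & Xk).
  destruct (Hpk k) as [GP Cl].
  exists (map (pk k) (seq 0 n)); split; auto.
  intros W (_ & _ & St). apply Nat.nlt_ge; intros L.
  (* A second pigeonhole, now over the [n] chains: with fewer than [n] witnesses, two wedges would
     share one. *)
  destruct (pigeonhole _ (fun j w => 0 < dot (vsub w (pk k O)) (v j) /\
      dot (vsub w (pk k O)) (normal (pk k) (v j) n) < 0) W n)
    as (i & j & w & Hij & _ & [I1 I2] & [J1 J2]); auto.
  { intros j Hj. apply chain_overlap; auto. apply chain_stabbed; auto. }
  destruct (Xk j ltac:(lia) i ltac:(lia) ltac:(lia)) as (X1 & X2 & X3).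
  specialize (X i j ltac:(lia)).
  clearbody v.
  apply (no_common_half_plane (v j) (v i) (vscale (-1) (normal (pk k) (v j) n))
           (vscale (-1) (normal (pk k) (v i) n)) (vsub w (pk k O))); auto.
  1-3: unfold cross, vscale in *; simpl; lra.
  rewrite !dot_scale_r; repeat split; lra.
Qed.

(* n <= st_D(n) = max_P st_D(P)  <->  some P has st_D(P) >= n;
   st_D(n) <= 2n-2              <->  every P has st_D(P) <= 2n-2. *)
Theorem mainTheorem14 (n : nat) (hn : (2 <= n)%nat) :
  (exists P, gp_set n P /\ stD_ge P n) /\
  (forall P, gp_set n P -> stD_le P (2 * n - 2)).
Proof.
  split; [|intros P; apply stD_upper, hn].
  destruct (Nat.eq_dec n 2) as [->|N]; [apply stD_lower_two|].
  destruct (Nat.even n) eqn:E; [apply stD_lower_even | apply stD_lower_odd]; auto; lia.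
Qed.
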